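(* Let $k, p \in \mathbb{R}^{+}$, $m \in \mathbb{N}$ and $a, b \in \mathbb{R}$. Define $$\mathcal{F}(k,m,a,b,p) = \int_0^\infty x^{k-1} Q_m(a\sqrt{x}, b)\, e^{-px}\,{\rm d}x .$$ Then $$\mathcal{F}(k,m,a,b,p) = \frac{\Gamma(k)}{p^k} - \frac{2^k\Gamma(k)\, e^{-\frac{b^2}{2}}}{(a^2+2p)^k}\,\Phi_2\!\left(1,k,1;\frac{b^2}{2},\frac{a^2b^2}{2a^2+4p}\right) + \frac{2^k\Gamma(k)\, e^{-\frac{b^2}{2}}}{(a^2+2p)^k}\sum_{n=0}^{m-1}\frac{b^{2n}}{n!\,2^n}\,{}_1F_1\!\left(k;n+1;\frac{a^2b^2}{2a^2+4p}\right).$$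
   Context: $Q_m(\alpha,\beta)$ is the generalized Marcum $Q$-function, $Q_m(\alpha,\beta) = \alpha^{1-m}\int_\beta^\infty t^{m} e^{-(t^2+\alpha^2)/2} I_{m-1}(\alpha t)\,{\rm d}t$ (with the limiting value for $\alpha=0$), where $I_{\nu}$ is the modified Bessel function of the first kind. $\Gamma$ is the Euler Gamma function, $(x)_n=\Gamma(x+n)/\Gamma(x)$ is the Pochhammer symbol, ${}_1F_1(\alpha;\gamma;z)=\sum_{l\ge 0}\frac{(\alpha)_l}{(\gamma)_l}\frac{z^l}{l!}$ is the Kummer confluent hypergeometric function, and $\Phi_2$ is the Humbert hypergeometric function of the second kind, $\Phi_2(\beta,\beta',\gamma;x,y)=\sum_{n\ge0}\sum_{l\ge0}\frac{(\beta)_n(\beta')_l}{(\gamma)_{n+l}}\frac{x^n}{n!}\frac{y^l}{l!}$. *)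

(* Defs.v *)
From Stdlib Require Import Reals Factorial.
From Coquelicot Require Import Coquelicot.
Open Scope R_scope.

Definition Gamma (x : R) : R :=
  RInt_gen (fun t => Rpower t (x - 1) * exp (- t))
           (at_right 0) (Rbar_locally p_infty).

Definition poch (x : R) (n : nat) : R := Gamma (x + INR n) / Gamma x.

Definition BesselI (n : nat) (z : R) : R :=
  Series (fun j => (z / 2) ^ (2 * j + n) / (INR (fact j) * Gamma (INR j + INR n + 1))).

(* Generalized Marcum Q-function for integer order m >= 1 and alpha <> 0:
   alpha^(1-m) int_beta^oo t^m exp(-(t^2+alpha^2)/2) I_{m-1}(alpha t) dt *)
Definition MarcumQ_nz (m : nat) (alpha beta : R) : R :=
  / alpha ^ (m - 1) *
  RInt_gen (fun t => t ^ m * exp (- (t ^ 2 + alpha ^ 2) / 2) * BesselI (m - 1) (alpha * t))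
           (at_point beta) (Rbar_locally p_infty).

Definition MarcumQ (m : nat) (alpha beta : R) : R :=
  match Req_EM_T alpha 0 with
  | left _ => real (Lim (fun a => MarcumQ_nz m a beta) 0)
  | right _ => MarcumQ_nz m alpha beta
  end.

Definition hyp1F1 (al ga z : R) : R :=
  Series (fun l => poch al l / poch ga l * z ^ l / INR (fact l)).

Definition Phi2 (be be' ga x y : R) : R :=
  Series (fun n => Series (fun l =>
    poch be n * poch be' l / poch ga (n + l) * (x ^ n / INR (fact n)) * (y ^ l / INR (fact l)))).

Definition F_integrand (k : R) (m : nat) (a b p : R) (x : R) : R :=
  Rpower x (k - 1) * MarcumQ m (a * sqrt x) b * exp (- p * x).

(* Main.v *)
Require Import Defs.
From Stdlib Require Import Reals Factorial Lra Lia.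
From Coquelicot Require Import Coquelicot.
Open Scope R_scope.

(* Put y = b^2/2, u = alpha^2/2 and T_j = sum_(i >= m+j) y^i/i!.  Expanding the Bessel
   function and integrating term by term gives
     1 - Q_m(alpha, b) = e^(-y-u) sum_j u^j/j! T_j.
   As T_j decreases to 0 and e^(-u) sum_j u^j/j! = 1, the partial sums in j converge
   uniformly in alpha, with error at most T_J; so for alpha = a sqrt x the weight
   x^(k-1) e^(-px) may be integrated term by term, each term being a Gamma integral.
   The resulting series sum_j (k)_j/j! w^j T_j, with w = a^2/(a^2+2p), is the Phi2 double
   series with the order of summation exchanged and the indices n < m removed; the
   removed part is the sum of 1F1 terms. *)

(** * Improper integrals and the Gamma function *)

(** [RInt_gen], [Series] and [Lim] return some value even without convergence, so nothing about
    Gamma, I or Q can be used before the convergence behind it is proved; hence the direct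
    construction of the Gamma integral. Both exchanges of series and integral go through one
    dominated limit lemma, in which the error is err_J times a fixed integrable weight. For the
    integral in t the weight is e^(-t): half of the Gaussian decay is spent on bounding (t^2/2)^N/N!
    by 2^N e^(t^2/4), and the powers 2^j so produced turn the remainder into a tail of e^(2u). For
    the integral in x, the factor e^(-u) of 1 - Q cancels the e^u of the error, which leaves the
    weight x^(k-1) e^(-px), the same for all J. Negative b needs no separate case: the Gaussian
    primitive is even in t, and the bounds in t hold on the whole line. *)

Lemma is_RInt_gen_eps (f : R -> R) (Fa Fb : (R -> Prop) -> Prop) (l : R) :
  Filter Fa -> Filter Fb ->
  is_RInt_gen f Fa Fb l <->
  (forall eps : posreal, filter_prod Fa Fb
     (fun ab => exists v, is_RInt f (fst ab) (snd ab) v /\ Rabs (v - l) < eps)).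
Proof.
  intros FFa FFb; split.
  - intros H eps; exact (H _ (locally_ball l eps)).
  - intros H P [eps HP].
    unfold filtermapi.
    generalize (H eps); apply filter_imp.
    intros ab [v [Hv1 Hv2]]; exists v; split; [exact Hv1|].
    apply HP; exact Hv2.
Qed.

Lemma is_RInt_uniform_limit (f : R -> R) (fJ : nat -> R -> R) (err : nat -> R) (a b : R) :
  a <= b ->
  (forall J, ex_RInt (fJ J) a b) ->
  (forall J x, a <= x <= b -> Rabs (f x - fJ J x) <= err J) ->
  is_lim_seq err 0 ->
  is_RInt f a b (RInt f a b) /\
  is_lim_seq (fun J => RInt (fJ J) a b) (RInt f a b).
Proof.
  intros Hab Hex Hb Hlim.
  (* [filterlim_RInt] asks for uniform convergence on the whole line; composing with the projection
     onto [a, b] provides it and changes nothing inside the interval. *)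
  set (clamp := fun x => Rmax a (Rmin b x)).
  assert (Hc : forall x, a <= clamp x <= b).
  { intros x; unfold clamp, Rmax, Rmin.
    destruct (Rle_dec b x); destruct (Rle_dec a _); lra. }
  assert (Hid : forall x, Rmin a b < x < Rmax a b -> clamp x = x).
  { intros x; rewrite Rmin_left, Rmax_right by assumption; intros Hx.
    unfold clamp, Rmax, Rmin.
    destruct (Rle_dec b x); destruct (Rle_dec a _); lra. }
  destruct (filterlim_RInt (fun J x => fJ J (clamp x)) a b eventually _
              (fun x => f (clamp x)) (fun J => RInt (fJ J) a b)) as [If [H1 H2]].
  - intros J; apply is_RInt_ext with (fJ J); [|now apply (RInt_correct (fJ J))].
    intros x Hx; now rewrite Hid.
  - apply filterlim_locally; intros eps.
    destruct (proj1 (is_lim_seq_Reals _ _) Hlim eps (cond_pos eps)) as [N HN].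
    exists N; intros J HJ x; change (Rabs (fJ J (clamp x) - f (clamp x)) < eps).
    rewrite Rabs_minus_sym.
    apply Rle_lt_trans with (1 := Hb J _ (Hc x)).
    apply Rle_lt_trans with (1 := Rle_abs _).
    generalize (HN J HJ); unfold Rdist; now rewrite Rminus_0_r.
  - assert (Hf : is_RInt f a b If).
    { apply is_RInt_ext with (2 := H2); intros x Hx; now rewrite Hid. }
    rewrite (is_RInt_unique _ _ _ _ Hf); split; assumption.
Qed.

(** On a compact range [w] is bounded, so [fJ] converges uniformly there and [f] is integrable. The
    index J is fixed before the endpoints: near the limit the integral of [w] is at most |W| + 1, so
    replacing [f] by [fJ J] costs at most eps/3 whatever the range. *)
Lemma is_RInt_gen_dominated_limit (Fa Fb : (R -> Prop) -> Prop)
    (f w : R -> R) (fJ : nat -> R -> R) (I err : nat -> R) (W L : R) :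
  Filter Fa -> Filter Fb ->
  (forall J, is_RInt_gen (fJ J) Fa Fb (I J)) ->
  is_RInt_gen w Fa Fb W ->
  is_lim_seq err 0 -> is_lim_seq I L ->
  filter_prod Fa Fb (fun ab => fst ab <= snd ab /\
    forall x, fst ab <= x <= snd ab ->
      (0 <= w x /\ continuous w x) /\ forall J, continuous (fJ J) x /\ Rabs (f x - fJ J x) <= err J * w x) ->
  is_RInt_gen f Fa Fb L.
Proof.
  intros FFa FFb HJ Hw Herr HI Hnear.
  apply is_RInt_gen_eps; try assumption; intros eps.
  assert (Hpos : 0 < eps / 3) by (generalize (cond_pos eps); lra).
  destruct (proj1 (is_lim_seq_Reals _ _) HI _ Hpos) as [N1 HN1].
  assert (HW0 : 0 < Rabs W + 1) by (generalize (Rabs_pos W); lra).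
  assert (Hpos2 : 0 < eps / 3 / (Rabs W + 1)) by (apply Rdiv_lt_0_compat; assumption).
  destruct (proj1 (is_lim_seq_Reals _ _) Herr _ Hpos2) as [N2 HN2].
  set (J := max N1 N2).
  specialize (HN1 J (Nat.le_max_l _ _)); specialize (HN2 J (Nat.le_max_r _ _)).
  unfold Rdist in HN1, HN2; rewrite Rminus_0_r in HN2.
  generalize (proj1 (is_RInt_gen_eps _ _ _ _ _ _) (HJ J) (mkposreal _ Hpos)); intros A1.
  generalize (proj1 (is_RInt_gen_eps _ _ _ _ _ _) Hw (mkposreal _ Rlt_0_1)); intros A2.
  generalize (filter_and _ _ Hnear (filter_and _ _ A1 A2)).
  apply filter_imp; intros [a b]; simpl.
  intros [[Hab Hx] [[v1 [Hv1 Hv1']] [v2 [Hv2 Hv2']]]].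
  assert (Hcw : forall x, a <= x <= b -> continuity_pt w x).
  { intros x Hx'; apply continuity_pt_filterlim; exact (proj2 (proj1 (Hx x Hx'))). }
  destruct (continuity_ab_maj w a b Hab Hcw) as [Mx [HMx _]].
  destruct (is_RInt_uniform_limit f fJ (fun J => Rabs (err J) * Rabs (w Mx)) a b Hab)
    as [Hf _].
  - intros j; apply (ex_RInt_continuous (fJ j)); intros z.
    rewrite Rmin_left, Rmax_right by assumption; intros Hz.
    exact (proj1 (proj2 (Hx z Hz) j)).
  - intros j x Hx'.
    destruct (Hx x Hx') as [[Hw0 _] Hj]; destruct (Hj j) as [_ Hb].
    apply Rle_trans with (1 := Hb).
    apply Rle_trans with (Rabs (err j) * w x).
    + apply Rmult_le_compat_r; [assumption | apply Rle_abs].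
    + apply Rmult_le_compat_l; [apply Rabs_pos |].
      apply Rle_trans with (2 := Rle_abs _); now apply HMx.
  - replace (Finite 0) with (Rbar_mult 0 (Rabs (w Mx))) by (simpl; f_equal; ring).
    apply is_lim_seq_scal_r, (proj1 (is_lim_seq_abs_0 err)); exact Herr.
  - exists (RInt f a b); split; [exact Hf|].
    assert (Hdiff : is_RInt (fun x => f x - fJ J x) a b (RInt f a b - v1))
      by (apply (is_RInt_minus f (fJ J)); assumption).
    assert (Hb1 : Rabs (RInt f a b - v1) <= err J * v2).
    { apply (norm_RInt_le (fun x => f x - fJ J x) (fun x => err J * w x) a b);
        [assumption| | exact Hdiff | apply (is_RInt_scal w); exact Hv2].
      intros x Hx'; exact (proj2 (proj2 (Hx x Hx') J)). }
    assert (Hv2b : Rabs v2 <= Rabs W + 1).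
    { generalize (Rabs_triang (v2 - W) W); replace (v2 - W + W) with v2 by ring; lra. }
    assert (Hb2 : err J * v2 <= eps / 3).
    { apply Rle_trans with (1 := Rle_abs _); rewrite Rabs_mult.
      replace (eps / 3) with (eps / 3 / (Rabs W + 1) * (Rabs W + 1)) by (field; lra).
      apply Rmult_le_compat; try apply Rabs_pos; lra. }
    replace (RInt f a b - L) with ((RInt f a b - v1) + ((v1 - I J) + (I J - L))) by ring.
    apply Rle_lt_trans with (1 := Rabs_triang _ _).
    generalize (Rabs_triang (v1 - I J) (I J - L)); lra.
Qed.

Lemma Rpower_pos (x y : R) : 0 < Rpower x y.
Proof. apply exp_pos. Qed.

Lemma at_right_0_infty_near (P : R -> R -> Prop) (s0 t0 : R) :
  0 < s0 -> (forall s t, 0 < s < s0 -> t0 < t -> P s t) ->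
  filter_prod (at_right 0) (Rbar_locally p_infty) (fun st => P (fst st) (snd st)).
Proof.
  intros Hs0 HP.
  exists (fun s => 0 < s < s0) (fun t => t0 < t).
  - exists (mkposreal _ Hs0); intros s Hs Hs'; split; [exact Hs'|].
    generalize (Rle_lt_trans _ _ _ (Rle_abs _) Hs); simpl.
    unfold minus, plus, opp; simpl; lra.
  - now exists t0.
  - intros s t Hs Ht; now apply HP.
Qed.

(** Integrals of a positive function grow with the range, so their supremum is the limit. The strict
    bound [0 < l], read off from [1, 2], is what later allows division by [Gamma]. *)
Lemma is_RInt_gen_bounded_nonneg (f : R -> R) (M : R) :
  (forall t, 0 < t -> 0 < f t) -> (forall t, 0 < t -> continuous f t) ->
  (forall s t, 0 < s -> s <= t -> RInt f s t <= M) ->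
  exists l, 0 < l /\ is_RInt_gen f (at_right 0) (Rbar_locally p_infty) l.
Proof.
  intros Hpos Hc HM.
  assert (Hex : forall s t, 0 < s -> s <= t -> ex_RInt f s t).
  { intros s t Hs Hst; apply (ex_RInt_continuous f); intros z.
    rewrite Rmin_left, Rmax_right by assumption; intros Hz; apply Hc; lra. }
  destruct (completeness (fun v => exists s t, 0 < s /\ s <= t /\ v = RInt f s t)) as [l [Hub Hlub]].
  - exists M; intros v [s [t [Hs [Hst Hv]]]]; rewrite Hv; now apply HM.
  - exists (RInt f 1 1), 1, 1; repeat split; lra.
  - exists l; split.
    + apply Rlt_le_trans with (RInt f 1 2).
      * apply RInt_gt_0; [lra | |]; intros x Hx; [apply Hpos | apply Hc]; lra.
      * apply Hub; exists 1, 2; repeat split; lra.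
    + apply is_RInt_gen_eps; try apply _; intros eps.
      assert (Hne : exists s t, 0 < s /\ s <= t /\ l - eps < RInt f s t).
      { destruct (Classical_Prop.classic (exists s t, 0 < s /\ s <= t /\ l - eps < RInt f s t))
          as [|Hn]; [assumption|].
        assert (l <= l - eps); [|generalize (cond_pos eps); lra].
        apply Hlub; intros v [s [t [Hs [Hst Hv]]]].
        apply Rnot_lt_le; intros Hlt; apply Hn; exists s, t; rewrite <- Hv; auto. }
      destruct Hne as [s0 [t0 [Hs0 [Hst0 Hl]]]].
      apply (at_right_0_infty_near
        (fun a b => exists v, is_RInt f a b v /\ Rabs (v - l) < eps) s0 t0 Hs0).
      intros s t Hs Ht; exists (RInt f s t); split.
      { apply (RInt_correct f), Hex; lra. }
      assert (E1 : RInt f s t = RInt f s s0 + RInt f s0 t).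
      { symmetry; apply (RInt_Chasles f); apply Hex; lra. }
      assert (E2 : RInt f s0 t = RInt f s0 t0 + RInt f t0 t).
      { symmetry; apply (RInt_Chasles f); apply Hex; lra. }
      assert (P1 : 0 <= RInt f s s0).
      { apply RInt_ge_0; [lra | apply Hex; lra |].
        intros x Hx; apply Rlt_le, Hpos; lra. }
      assert (P2 : 0 <= RInt f t0 t).
      { apply RInt_ge_0; [lra | apply Hex; lra |].
        intros x Hx; apply Rlt_le, Hpos; lra. }
      assert (P3 : RInt f s t <= l) by (apply Hub; exists s, t; repeat split; lra).
      apply Rabs_lt_between'; generalize (cond_pos eps); lra.
Qed.

Lemma exp_le_compat (x y : R) : x <= y -> exp x <= exp y.
Proof.
  intros [H | ->]; [apply Rlt_le, exp_increasing; exact H | apply Rle_refl].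
Qed.

(** r ln x - x is largest at x = r; the inequality is ln s <= s - 1 at s = x/r. *)
Lemma Rpower_le_exp (r x : R) : 0 < r -> 0 < x ->
  Rpower x r <= exp (r * ln r - r) * exp x.
Proof.
  intros Hr Hx; unfold Rpower; rewrite <- exp_plus.
  apply exp_le_compat.
  assert (Hrx : 0 < x / r) by now apply Rdiv_lt_0_compat.
  assert (H : ln (x / r) <= x / r - 1).
  { generalize (exp_ineq1_le (ln (x / r))); rewrite exp_ln by assumption; lra. }
  rewrite ln_div in H by assumption.
  assert (r * (ln x - ln r) <= r * (x / r - 1)) by (apply Rmult_le_compat_l; lra).
  replace (r * (x / r - 1)) with (x - r) in H0 by (field; lra); lra.
Qed.

Definition gamma_integrand (q c t : R) : R := Rpower t (q - 1) * exp (- (c * t)).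

Lemma is_derive_Rpower (x y : R) : 0 < x ->
  is_derive (fun t => Rpower t y) x (y * Rpower x (y - 1)).
Proof. intros Hx; apply is_derive_Reals; now apply derivable_pt_lim_power. Qed.

Lemma continuous_Rpower (x y : R) : 0 < x -> continuous (fun t => Rpower t y) x.
Proof.
  intros Hx; apply (ex_derive_continuous (fun t => Rpower t y)).
  eexists; now apply is_derive_Rpower.
Qed.

Lemma gamma_integrand_continuous (q c x : R) : 0 < x ->
  continuous (gamma_integrand q c) x.
Proof.
  intros Hx; apply (continuous_mult (fun t => Rpower t (q - 1)) (fun t => exp (- (c * t)))).
  - now apply continuous_Rpower.
  - apply (ex_derive_continuous (fun t => exp (- (c * t)))); auto_derive; trivial.
Qed.

Lemma gamma_integrand_pos (q c x : R) : 0 < gamma_integrand q c x.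
Proof. apply Rmult_lt_0_compat; apply exp_pos. Qed.

(* The majorant is a multiple of the derivative of the bounded function (t / (1 + t))^q. *)
Lemma gamma_integral_exists (q : R) : 0 < q ->
  exists l, 0 < l /\
    is_RInt_gen (gamma_integrand q 1) (at_right 0) (Rbar_locally p_infty) l.
Proof.
  intros Hq.
  (* [Rpower_le_exp] at 1 + x with exponent q + 1 gives (1+x)^(q+1) e^(-x) <= K. Hence the integrand
     is at most K x^(q-1)/(1+x)^(q+1), which is integrable at 0 and at infinity alike. *)
  set (K := exp ((q + 1) * ln (q + 1) - (q + 1)) * exp 1).
  assert (HK : 0 < K) by (apply Rmult_lt_0_compat; apply exp_pos).
  apply is_RInt_gen_bounded_nonneg with (K / q).
  - intros; apply gamma_integrand_pos.
  - intros; now apply gamma_integrand_continuous.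
  - intros s t Hs Hst.
    set (g := fun x => K / q * Rpower (x / (1 + x)) q).
    set (dg := fun x => K / q * (/ (1 + x) ^ 2 * (q * Rpower (x / (1 + x)) (q - 1)))).
    assert (Hd : forall x, 0 < x -> is_derive g x (dg x)).
    { intros x Hx; apply (is_derive_scal (fun x => Rpower (x / (1 + x)) q)).
      apply (is_derive_comp (fun y => Rpower y q) (fun x => x / (1 + x))).
      - apply is_derive_Rpower, Rdiv_lt_0_compat; lra.
      - auto_derive; [lra|]; field; lra. }
    assert (Hdc : forall x, 0 < x -> continuous dg x).
    { intros x Hx; unfold dg.
      apply (ex_derive_continuous dg). unfold dg, Rpower. auto_derive.
      repeat split; try lra; [| apply Rdiv_lt_0_compat; lra].
      apply Rgt_not_eq; nra. }
    assert (Hdg : is_RInt dg s t (g t - g s)).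
    { apply (is_RInt_derive g dg); intros x;
        rewrite Rmin_left, Rmax_right by assumption; intros Hx; [apply Hd | apply Hdc]; lra. }
    assert (Hgt : g t <= K / q).
    { rewrite <- (Rmult_1_r (K / q)); apply Rmult_le_compat_l.
      - apply Rlt_le, Rdiv_lt_0_compat; lra.
      - apply Rle_trans with (Rpower 1 q);
          [|right; unfold Rpower; rewrite ln_1, Rmult_0_r; apply exp_0].
        apply Rle_Rpower_l; [lra|]; split.
        + apply Rdiv_lt_0_compat; lra.
        + apply Rle_div_l; lra. }
    assert (Hgs : 0 <= g s).
    { apply Rmult_le_pos; [apply Rlt_le, Rdiv_lt_0_compat; lra | apply Rlt_le, exp_pos]. }
    apply Rle_trans with (g t - g s); [|lra].
    rewrite <- (is_RInt_unique _ _ _ _ Hdg).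
    apply RInt_le; [assumption | | exists (g t - g s); exact Hdg |].
    + apply (ex_RInt_continuous (gamma_integrand q 1)); intros z.
      rewrite Rmin_left, Rmax_right by assumption; intros Hz.
      apply gamma_integrand_continuous; lra.
    + intros x Hx; unfold gamma_integrand, dg.
      assert (Hx1 : 0 < 1 + x) by lra.
      assert (E : K / q * (/ (1 + x) ^ 2 * (q * Rpower (x / (1 + x)) (q - 1)))
                  = K / Rpower (1 + x) (q + 1) * Rpower x (q - 1)).
      { assert (E1 : Rpower (x / (1 + x)) (q - 1) = Rpower x (q - 1) / Rpower (1 + x) (q - 1)).
        { unfold Rpower, Rdiv at 2; rewrite <- exp_Ropp, <- exp_plus, ln_div by lra.
          f_equal; ring. }
        assert (E2 : Rpower (1 + x) (q + 1) = Rpower (1 + x) (q - 1) * (1 + x) ^ 2).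
        { rewrite <- Rpower_pow by assumption; rewrite <- Rpower_plus; f_equal; simpl; ring. }
        rewrite E1, E2.
        field. generalize (Rpower_pos (1 + x) (q - 1)); repeat split; lra. }
      rewrite E, Rmult_comm; apply Rmult_le_compat_r; [apply Rlt_le, Rpower_pos|].
      apply Rle_div_r; [apply Rpower_pos|].
      rewrite Rmult_1_l.
      apply Rle_trans with (exp (- x) * (exp ((q + 1) * ln (q + 1) - (q + 1)) * exp (1 + x))).
      * apply Rmult_le_compat_l; [apply Rlt_le, exp_pos|]; apply Rpower_le_exp; lra.
      * right; unfold K; rewrite <- !exp_plus; f_equal; ring.
Qed.

Lemma is_RInt_gen_primitive (Fa Fb : (R -> Prop) -> Prop) (g dg : R -> R) (la lb : R) :
  Filter Fa -> Filter Fb ->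
  filter_prod Fa Fb (fun ab => fst ab <= snd ab /\
    forall x, fst ab <= x <= snd ab -> is_derive g x (dg x) /\ continuous dg x) ->
  filterlim g Fa (locally la) -> filterlim g Fb (locally lb) ->
  is_RInt_gen dg Fa Fb (lb - la).
Proof.
  intros FFa FFb Hnear Ha Hb.
  apply is_RInt_gen_eps; try assumption; intros eps.
  set (e2 := pos_div_2 eps).
  assert (Ha' : filter_prod Fa Fb (fun ab => Rabs (g (fst ab) - la) < e2)).
  { apply (filterlim_fst (F := Fa) (G := Fb) (fun x => Rabs (g x - la) < e2)).
    exact (proj1 (filterlim_locally g la) Ha e2). }
  assert (Hb' : filter_prod Fa Fb (fun ab => Rabs (g (snd ab) - lb) < e2)).
  { apply (filterlim_snd (F := Fa) (G := Fb) (fun x => Rabs (g x - lb) < e2)).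
    exact (proj1 (filterlim_locally g lb) Hb e2). }
  generalize (filter_and _ _ Hnear (filter_and _ _ Ha' Hb')); apply filter_imp.
  intros [a b]; simpl; intros [[Hab Hx] [H1 H2]].
  exists (g b - g a); split.
  - apply (is_RInt_derive g dg); intros x;
      rewrite Rmin_left, Rmax_right by assumption; intros Hx'; apply Hx, Hx'.
  - replace (g b - g a - (lb - la)) with ((g b - lb) - (g a - la)) by ring.
    apply Rle_lt_trans with (1 := Rabs_triang _ _); rewrite Rabs_Ropp; lra.
Qed.

Lemma at_right_0_infty_within (P : R -> Prop) :
  (forall x, 0 < x -> P x) ->
  filter_prod (at_right 0) (Rbar_locally p_infty)
    (fun ab => fst ab <= snd ab /\ forall x, fst ab <= x <= snd ab -> P x).
Proof.
  intros HP.
  apply (at_right_0_infty_near (fun a b => a <= b /\ forall x, a <= x <= b -> P x) 1 1 Rlt_0_1).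
  intros s t Hs Ht; split; [lra|]; intros x Hx; apply HP; lra.
Qed.

Lemma is_RInt_gen_0_infty_ext (f g : R -> R) (l : R) :
  (forall x, 0 < x -> f x = g x) ->
  is_RInt_gen f (at_right 0) (Rbar_locally p_infty) l ->
  is_RInt_gen g (at_right 0) (Rbar_locally p_infty) l.
Proof.
  intros H; apply is_RInt_gen_ext.
  generalize (at_right_0_infty_within _ H); apply filter_imp.
  intros [a b]; simpl; intros [Hab Hx] x; rewrite Rmin_left, Rmax_right by assumption.
  intros Hx'; apply Hx; lra.
Qed.

(** Only with this convergence does the total function [RInt_gen] make [Gamma q] the value of its
    integral. *)
Lemma Gamma_pos_and_correct (q : R) : 0 < q ->
  0 < Gamma q /\
  is_RInt_gen (gamma_integrand q 1) (at_right 0) (Rbar_locally p_infty) (Gamma q).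
Proof.
  intros Hq; destruct (gamma_integral_exists q Hq) as [l [Hl Hi]].
  replace (Gamma q) with l; [now split|].
  symmetry; apply is_RInt_gen_unique.
  apply is_RInt_gen_0_infty_ext with (2 := Hi); intros x _.
  unfold gamma_integrand; now rewrite Rmult_1_l.
Qed.

Lemma Gamma_pos (q : R) : 0 < q -> 0 < Gamma q.
Proof. intros Hq; apply (Gamma_pos_and_correct q Hq). Qed.

Lemma gamma_integral_scaled (q c : R) : 0 < q -> 0 < c ->
  is_RInt_gen (gamma_integrand q c) (at_right 0) (Rbar_locally p_infty)
    (Gamma q / Rpower c q).
Proof.
  intros Hq Hc.
  (* The substitution t = c y is made on finite ranges, whose endpoints are multiplied by c;
     [c * y + 0] is the affine form that [is_RInt_comp_lin] expects. *)
  assert (H : is_RInt_gen (fun y => scal c (gamma_integrand q 1 (c * y + 0)))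
                (at_right 0) (Rbar_locally p_infty) (Gamma q)).
  { apply is_RInt_gen_eps; try apply _; intros eps.
    destruct (proj1 (is_RInt_gen_eps _ _ _ _ _ _) (proj2 (Gamma_pos_and_correct q Hq)) eps)
      as [Q1 Q2 [d Hd] [M HM] HQ].
    assert (Hd' : 0 < d / c) by (apply Rdiv_lt_0_compat; [apply cond_pos | assumption]).
    apply (at_right_0_infty_near (fun a b => exists v,
       is_RInt (fun y => scal c (gamma_integrand q 1 (c * y + 0))) a b v /\
       Rabs (v - Gamma q) < eps) (d / c) (M / c) Hd').
    intros s t Hs Ht.
    destruct (HQ (c * s + 0) (c * t + 0)) as [v [Hv1 Hv2]].
    - assert (0 < c * s) by (apply Rmult_lt_0_compat; lra).
      assert (c * s < d) by (rewrite Rmult_comm; apply Rlt_div_r; lra).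
      apply Hd; [|lra].
      change (Rabs (c * s + 0 - 0) < d); rewrite Rabs_pos_eq; lra.
    - apply HM; rewrite Rplus_0_r, Rmult_comm; apply Rlt_div_l; lra.
    - exists v; split; [|assumption].
      apply (is_RInt_comp_lin (gamma_integrand q 1)); exact Hv1. }
  replace (Gamma q / Rpower c q) with (scal (/ Rpower c q) (Gamma q))
    by (unfold scal; simpl; unfold mult; simpl; field; apply Rgt_not_eq, Rpower_pos).
  generalize (is_RInt_gen_scal _ (/ Rpower c q) _ H).
  apply is_RInt_gen_0_infty_ext; intros x Hx.
  unfold scal; simpl; unfold mult; simpl; unfold gamma_integrand.
  rewrite Rplus_0_r, Rmult_1_l, <- Rpower_mult_distr by assumption.
  replace (Rpower c q) with (Rpower c (q - 1) * c).
  - field; split; [lra | apply Rgt_not_eq, Rpower_pos].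
  - rewrite <- (Rpower_1 c) at 2 by assumption; rewrite <- Rpower_plus; f_equal; ring.
Qed.

(** Integration by parts: the boundary term t^q e^(-t) vanishes at 0 and at infinity, so the
    integral of its derivative is 0. *)
Lemma Gamma_succ (q : R) : 0 < q -> Gamma (q + 1) = q * Gamma q.
Proof.
  intros Hq.
  set (g := fun t => Rpower t q * exp (- t)).
  set (dg := fun t => q * gamma_integrand q 1 t - gamma_integrand (q + 1) 1 t).
  assert (H0 : is_RInt_gen dg (at_right 0) (Rbar_locally p_infty) (0 - 0)).
  { apply (is_RInt_gen_primitive _ _ g dg); try apply _.
    - apply at_right_0_infty_within; intros x Hx; split.
      + assert (E : dg x = (q * Rpower x (q - 1)) * exp (- x) + Rpower x q * (- exp (- x))).
        { unfold dg, gamma_integrand; rewrite Rmult_1_l.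
          replace (q + 1 - 1) with q by ring; ring. }
        rewrite E; apply (is_derive_mult (fun t => Rpower t q) (fun t => exp (- t))).
        * now apply is_derive_Rpower.
        * auto_derive; trivial; ring.
        * intros; apply Rmult_comm.
      + apply (continuous_minus (fun t => q * gamma_integrand q 1 t) (gamma_integrand (q + 1) 1)).
        * apply (continuous_scal_r q (gamma_integrand q 1)); now apply gamma_integrand_continuous.
        * now apply gamma_integrand_continuous.
    - apply filterlim_locally; intros eps.
      assert (Hd : 0 < Rpower eps (/ q)) by apply Rpower_pos.
      exists (mkposreal _ Hd); intros x Hx Hx0.
      change (Rabs (x - 0) < Rpower eps (/ q)) in Hx; change (Rabs (g x - 0) < eps).
      rewrite Rminus_0_r, Rabs_pos_eq in Hx by lra.
      assert (Hgx : 0 < g x) by (apply Rmult_lt_0_compat; apply exp_pos).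
      rewrite Rminus_0_r, Rabs_pos_eq by lra.
      apply Rle_lt_trans with (Rpower x q).
      + unfold g; rewrite <- (Rmult_1_r (Rpower x q)) at 2.
        apply Rmult_le_compat_l; [apply Rlt_le, Rpower_pos|].
        rewrite <- exp_0; apply exp_le_compat; lra.
      + replace (pos eps) with (Rpower (Rpower eps (/ q)) q).
        * apply exp_increasing, Rmult_lt_compat_l; [assumption|]; now apply ln_increasing.
        * rewrite Rpower_mult, Rinv_l by lra; apply Rpower_1, cond_pos.
    - apply filterlim_locally; intros eps.
      (* K bounds x^(q+1) e^(-x), so the boundary term is at most K/x. *)
      set (K := exp ((q + 1) * ln (q + 1) - (q + 1))).
      exists (Rmax 1 (K / eps)); intros x Hx.
      assert (Hx1 : 1 < x) by (apply Rle_lt_trans with (2 := Hx), Rmax_l).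
      assert (HxK : K / eps < x) by (apply Rle_lt_trans with (2 := Hx), Rmax_r).
      change (Rabs (g x - 0) < eps).
      assert (Hgx : 0 < g x) by (apply Rmult_lt_0_compat; apply exp_pos).
      rewrite Rminus_0_r, Rabs_pos_eq by lra.
      assert (Hb : g x * x <= K).
      { apply Rle_trans with (Rpower x (q + 1) * exp (- x)).
        - right; unfold g; rewrite Rpower_plus, Rpower_1 by lra; ring.
        - apply Rle_trans with ((K * exp x) * exp (- x)).
          + apply Rmult_le_compat_r; [apply Rlt_le, exp_pos|]; apply Rpower_le_exp; lra.
          + right; rewrite Rmult_assoc, <- exp_plus, Rplus_opp_r, exp_0; ring. }
      apply Rlt_div_l in HxK; [|apply cond_pos].
      apply Rmult_lt_reg_r with x; [lra|]; lra. }
  assert (H1 : is_RInt_gen dg (at_right 0) (Rbar_locally p_infty) (q * Gamma q - Gamma (q + 1))).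
  { apply (is_RInt_gen_minus (fun t => q * gamma_integrand q 1 t) (gamma_integrand (q + 1) 1)).
    - apply (is_RInt_gen_scal (gamma_integrand q 1)), Gamma_pos_and_correct, Hq.
    - apply Gamma_pos_and_correct; lra. }
  apply (is_RInt_gen_unique dg) in H0; apply (is_RInt_gen_unique dg) in H1.
  rewrite H1 in H0; lra.
Qed.

Lemma Gamma_1 : Gamma 1 = 1.
Proof.
  destruct (Gamma_pos_and_correct 1 Rlt_0_1) as [_ H].
  apply (is_RInt_gen_unique (gamma_integrand 1 1)) in H; rewrite <- H; apply is_RInt_gen_unique.
  replace 1 with (0 - (-1)) at 3 by ring.
  apply (is_RInt_gen_primitive _ _ (fun t => - exp (- t))); try apply _.
  - apply at_right_0_infty_within; intros x Hx; split.
    + unfold gamma_integrand; rewrite Rminus_diag, Rpower_O by assumption.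
      auto_derive; trivial; ring_simplify (- (1 * x)); ring.
    + now apply gamma_integrand_continuous.
  - apply (filterlim_filter_le_1 (G := at_right 0) (F := locally 0)).
    + intros P [d Hd]; exists d; intros y Hy _; now apply Hd.
    + replace (-1) with (- exp (- 0)) by (rewrite Ropp_0, exp_0; ring).
      apply (ex_derive_continuous (fun t => - exp (- t))); auto_derive; trivial.
  - replace 0 with (Ropp 0) by ring.
    apply (filterlim_comp _ _ _ (fun t => exp (- t)) Ropp _ (locally 0)).
    + apply (filterlim_comp _ _ _ Ropp exp _ (Rbar_locally m_infty)).
      * apply (filterlim_Rbar_opp p_infty).
      * apply is_lim_exp_m.
    + apply (filterlim_Rbar_opp 0).
Qed.

Lemma Gamma_nat (n : nat) : Gamma (INR n + 1) = INR (fact n).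
Proof.
  induction n as [|n IH].
  - simpl; rewrite Rplus_0_l; exact Gamma_1.
  - rewrite S_INR, Gamma_succ by (generalize (pos_INR n); lra).
    rewrite IH, fact_simpl, mult_INR, S_INR; reflexivity.
Qed.

(** * Exponential series *)

Lemma ex_series_dominated (a b : nat -> R) :
  (forall j, Rabs (a j) <= b j) -> ex_series b -> ex_series a.
Proof. intros H; apply (ex_series_le a b H). Qed.

Lemma series_tail_bound (a b : nat -> R) (B : R) (J : nat) :
  ex_series a -> is_series b B -> (forall j, (J < j)%nat -> Rabs (a j) <= b j) ->
  Rabs (Series a - sum_n a J) <= B - sum_n b J.
Proof.
  intros Ha Hb H.
  assert (Hta : is_series (fun k => a (S J + k)%nat) (Series a - sum_n a J)).
  { apply (is_series_incr_n a (S J)); [lia|]; simpl pred.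
    replace (plus _ _) with (Series a); [now apply Series_correct|].
    change (Series a = Series a - sum_n a J + sum_n a J); ring. }
  assert (Htb : is_series (fun k => b (S J + k)%nat) (B - sum_n b J)).
  { apply (is_series_incr_n b (S J)); [lia|]; simpl pred.
    replace (plus _ _) with B; [assumption|].
    change (B = B - sum_n b J + sum_n b J); ring. }
  rewrite <- (is_series_unique _ _ Hta), <- (is_series_unique _ _ Htb).
  assert (Hk : forall k, Rabs (a (S J + k)%nat) <= b (S J + k)%nat) by (intros k; apply H; lia).
  apply Rle_trans with (Series (fun k => Rabs (a (S J + k)%nat))).
  - apply Series_Rabs, ex_series_dominated with (fun k => b (S J + k)%nat).
    + intros k; rewrite Rabs_Rabsolu; apply Hk.
    + eexists; exact Htb.
  - apply Series_le; [|eexists; exact Htb].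
    intros k; split; [apply Rabs_pos | apply Hk].
Qed.

Definition expterm (y : R) (i : nat) : R := y ^ i / INR (fact i).

(** [sum_n] includes its upper index, so this is the sum over i > N; with m = M + 1, the T_j of the
    overview is [exp_tail y (j + M)]. *)
Definition exp_tail (y : R) (N : nat) : R := exp y - sum_n (expterm y) N.

Lemma is_series_expterm (y : R) : is_series (expterm y) (exp y).
Proof.
  apply is_series_ext with (2 := is_exp_Reals y); intros n.
  unfold scal; simpl; unfold mult; simpl; rewrite pow_n_pow; reflexivity.
Qed.

Lemma expterm_nonneg (y : R) (i : nat) : 0 <= y -> 0 <= expterm y i.
Proof.
  intros Hy; apply Rdiv_le_0_compat; [now apply pow_le | apply INR_fact_lt_0].
Qed.

Lemma sum_n_nonneg_le (a : nat -> R) (N k : nat) :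
  (forall i, 0 <= a i) -> sum_n a N <= sum_n a (N + k).
Proof.
  intros Ha; induction k as [|k IH]; [rewrite Nat.add_0_r; lra|].
  rewrite Nat.add_succ_r, sum_Sn; unfold plus; simpl; generalize (Ha (S (N + k))); lra.
Qed.

Lemma sum_n_le_series (a : nat -> R) (l : R) (N : nat) :
  (forall i, 0 <= a i) -> is_series a l -> sum_n a N <= l.
Proof.
  intros Ha Hl.
  assert (H : is_lim_seq (fun k => sum_n a (k + N)) l)
    by (apply (is_lim_seq_incr_n (sum_n a) N l); exact Hl).
  apply (is_lim_seq_le (fun _ => sum_n a N) (fun k => sum_n a (k + N)) (sum_n a N) l).
  - intros k; rewrite Nat.add_comm; now apply sum_n_nonneg_le.
  - apply is_lim_seq_const.
  - exact H.
Qed.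

Lemma term_le_series (a : nat -> R) (l : R) (N : nat) :
  (forall i, 0 <= a i) -> is_series a l -> a N <= l.
Proof.
  intros Ha Hl; apply Rle_trans with (sum_n a N); [|now apply sum_n_le_series].
  destruct N as [|N]; [rewrite sum_O; lra|].
  rewrite sum_Sn; unfold plus; simpl.
  assert (0 <= sum_n a N); [|lra].
  apply Rle_trans with (sum_n a 0); [rewrite sum_O; apply Ha | apply (sum_n_nonneg_le a 0 N Ha)].
Qed.

Lemma exp_tail_nonneg (y : R) (N : nat) : 0 <= y -> 0 <= exp_tail y N.
Proof.
  intros Hy; unfold exp_tail.
  generalize (sum_n_le_series (expterm y) _ N (fun i => expterm_nonneg y i Hy) (is_series_expterm y)).
  lra.
Qed.

Lemma exp_tail_decr (y : R) (N k : nat) : 0 <= y -> exp_tail y (N + k) <= exp_tail y N.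
Proof.
  intros Hy; unfold exp_tail.
  generalize (sum_n_nonneg_le (expterm y) N k (fun i => expterm_nonneg y i Hy)); lra.
Qed.

Lemma exp_tail_lim (y : R) : is_lim_seq (exp_tail y) 0.
Proof.
  replace (Finite 0) with (Finite (exp y - exp y)) by (f_equal; ring).
  apply is_lim_seq_minus'; [apply is_lim_seq_const | apply is_series_expterm].
Qed.

Lemma expterm_scale (c y : R) (i : nat) : expterm (c * y) i = c ^ i * expterm y i.
Proof. unfold expterm; rewrite Rpow_mult_distr; unfold Rdiv; ring. Qed.

(** Against e^(-s) this leaves the decay e^(-s/2), and the price 2^i is geometric, so the
    coefficients u^j/j! absorb it. *)
Lemma expterm_le_half_exp (s : R) (i : nat) : 0 <= s -> expterm s i <= 2 ^ i * exp (s / 2).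
Proof.
  intros Hs; replace s with (2 * (s / 2)) at 1 by field; rewrite expterm_scale.
  apply Rmult_le_compat_l; [apply pow_le; lra|].
  apply (term_le_series (expterm (s / 2)));
    [intros; apply expterm_nonneg; lra | apply is_series_expterm].
Qed.

(** * Gaussian moments and their primitives *)

Definition gauss_moment (N : nat) (t : R) : R :=
  t * exp (- (t ^ 2 / 2)) * expterm (t ^ 2 / 2) N.

(** In s = t^2/2, [gauss_moment] is the Gamma density e^(-s) s^N/N! ds, and this is minus the
    regularized upper incomplete Gamma function of order N + 1. *)
Definition gauss_primitive (N : nat) (t : R) : R :=
  - (exp (- (t ^ 2 / 2)) * sum_n (expterm (t ^ 2 / 2)) N).

(** Induction telescopes: in s = t^2/2 the derivative of -e^(-s) s^(N+1)/(N+1)! is the difference of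
    two consecutive densities. *)
Lemma is_derive_gauss_primitive (N : nat) (t : R) :
  is_derive (gauss_primitive N) t (gauss_moment N t).
Proof.
  induction N as [|N IH].
  - apply is_derive_ext with (fun t => - exp (- (t ^ 2 / 2))).
    + intros x; unfold gauss_primitive; rewrite sum_O; unfold expterm; simpl; field.
    + unfold gauss_moment, expterm; simpl fact; auto_derive; trivial.
      replace (t * (t * 1) * / 2) with (t ^ 2 / 2) by (simpl; field).
      change (INR 1) with 1; field.
  - apply is_derive_ext with
      (fun t => gauss_primitive N t + - (exp (- (t ^ 2 / 2)) * expterm (t ^ 2 / 2) (S N))).
    + intros x; unfold gauss_primitive; rewrite sum_Sn; unfold plus; simpl; ring.
    + replace (gauss_moment (S N) t)
        with (gauss_moment N t + (gauss_moment (S N) t - gauss_moment N t)) by ring.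
      apply (is_derive_plus (gauss_primitive N)); [exact IH|].
      unfold gauss_moment, expterm; rewrite fact_simpl, mult_INR.
      assert (HN : INR (S N) <> 0) by (apply not_0_INR; lia).
      assert (HF : INR (fact N) <> 0) by apply INR_fact_neq_0.
      auto_derive; trivial.
      change (pred (S N)) with N.
      replace (t * (t * 1) * / 2) with (t ^ 2 / 2) by (simpl; field).
      change (match N with 0%nat => 1 | S _ => INR N + 1 end) with (INR (S N)).
      rewrite <- !(tech_pow_Rmult (t ^ 2 / 2)); field; split; assumption.
Qed.

Lemma gauss_moment_continuous (N : nat) (t : R) : continuous (gauss_moment N) t.
Proof.
  apply (ex_derive_continuous (gauss_moment N)); unfold gauss_moment, expterm.
  auto_derive; trivial.
Qed.

Lemma is_lim_exp_opp_infty (c : R) :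
  filterlim (fun t => c * exp (- t)) (Rbar_locally p_infty) (locally 0).
Proof.
  replace 0 with (c * 0) by ring.
  apply (filterlim_comp _ _ _ (fun t => exp (- t)) (Rmult c) _ (locally 0)).
  - apply (filterlim_comp _ _ _ Ropp exp _ (Rbar_locally m_infty)).
    + apply (filterlim_Rbar_opp p_infty).
    + apply is_lim_exp_m.
  - apply (filterlim_Rbar_mult_l c 0).
Qed.

Lemma is_RInt_gen_gauss_moment (N : nat) (b : R) :
  is_RInt_gen (gauss_moment N) (at_point b) (Rbar_locally p_infty)
    (exp (- (b ^ 2 / 2)) * sum_n (expterm (b ^ 2 / 2)) N).
Proof.
  replace (exp (- (b ^ 2 / 2)) * sum_n (expterm (b ^ 2 / 2)) N)
    with (0 - gauss_primitive N b) by (unfold gauss_primitive; ring).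
  apply (is_RInt_gen_primitive _ _ (gauss_primitive N)); try apply _.
  - exists (fun x => x = b) (fun x => b < x); [reflexivity | now exists b |].
    intros x y -> Hy; simpl; split; [lra|].
    intros x Hx; split; [apply is_derive_gauss_primitive | apply gauss_moment_continuous].
  - intros P HP; apply (locally_singleton _ _ HP).
  (* For the limit at infinity the whole partial sum is bounded as its terms are, each factor 2^i
     being at most 2^N. *)
  - assert (Hs : forall s, 0 <= s -> sum_n (expterm s) N <= 2 ^ N * exp (s / 2)).
    { intros s Hs; apply Rle_trans with (2 ^ N * sum_n (expterm (s / 2)) N).
      - clear -Hs; induction N as [|N IH].
        + rewrite !sum_O; unfold expterm; simpl; lra.
        + rewrite !sum_Sn; unfold plus; simpl plus.
          replace (expterm s (S N)) with (2 ^ S N * expterm (s / 2) (S N))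
            by (rewrite <- expterm_scale; f_equal; field).
          assert (0 <= sum_n (expterm (s / 2)) N).
          { apply Rle_trans with (sum_n (expterm (s / 2)) 0).
            - rewrite sum_O; apply expterm_nonneg; lra.
            - apply (sum_n_nonneg_le _ 0 N); intros; apply expterm_nonneg; lra. }
          assert (0 < 2 ^ N) by (apply pow_lt; lra).
          assert (0 <= 2 ^ N * sum_n (expterm (s / 2)) N) by (apply Rmult_le_pos; lra).
          change (sum_n (expterm s) N + 2 ^ S N * expterm (s / 2) (S N) <=
            2 ^ S N * (sum_n (expterm (s / 2)) N + expterm (s / 2) (S N))).
          rewrite Rmult_plus_distr_l; apply Rplus_le_compat_r; simpl; lra.
      - apply Rmult_le_compat_l; [apply pow_le; lra|].
        apply sum_n_le_series; [intros; apply expterm_nonneg; lra | apply is_series_expterm]. }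
    apply (is_lim_le_le_loc (fun t => - (2 ^ N * exp 1) * exp (- t)) (fun _ => 0)
             (gauss_primitive N) p_infty 0).
    + exists 0; intros t Ht; unfold gauss_primitive.
      set (s := t ^ 2 / 2).
      assert (Hs0 : 0 <= s) by (unfold s; nra).
      generalize (Hs s Hs0); intros Hb.
      assert (0 <= sum_n (expterm s) N).
      { apply Rle_trans with (sum_n (expterm s) 0).
        - rewrite sum_O; now apply expterm_nonneg.
        - apply (sum_n_nonneg_le _ 0 N); intros; now apply expterm_nonneg. }
      assert (He := exp_pos (- s)).
      split; [|assert (0 <= exp (- s) * sum_n (expterm s) N) by (apply Rmult_le_pos; lra); lra].
      assert (Hm : exp (- s) * sum_n (expterm s) N <= exp (- s) * (2 ^ N * exp (s / 2)))
        by (apply Rmult_le_compat_l; lra).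
      (* The exponent on the left is -t^2/4, which is at most 1 - t because (t/2 - 1)^2 >= 0. *)
      assert (Hm2 : exp (- s) * exp (s / 2) <= exp 1 * exp (- t)).
      { rewrite <- !exp_plus; apply exp_le_compat; unfold s.
        generalize (pow2_ge_0 (t / 2 - 1)); intros Hq; simpl in Hq |- *; lra. }
      assert (Hm3 : 2 ^ N * (exp (- s) * exp (s / 2)) <= 2 ^ N * (exp 1 * exp (- t)))
        by (apply Rmult_le_compat_l; [apply pow_le; lra | assumption]).
      lra.
    + apply is_lim_exp_opp_infty.
    + apply is_lim_const.
Qed.

(** * The Marcum function *)

(** After |t| <= e^|t| the exponent is |t| - t^2/4, and (|t|/2 - 2)^2 >= 0 bounds it by 4 - |t| <= 4
    - t; this is the origin of [exp 4]. *)
Lemma gauss_moment_bound (N : nat) (t : R) :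
  Rabs (gauss_moment N t) <= 2 ^ N * (exp 4 * exp (- t)).
Proof.
  unfold gauss_moment; set (s := t ^ 2 / 2).
  assert (Hs : 0 <= s) by (unfold s; generalize (pow2_ge_0 t); lra).
  rewrite !Rabs_mult, (Rabs_pos_eq (exp _)), (Rabs_pos_eq (expterm _ _))
    by (try apply expterm_nonneg; try apply Rlt_le, exp_pos; assumption).
  apply Rle_trans with (Rabs t * exp (- s) * (2 ^ N * exp (s / 2))).
  - apply Rmult_le_compat_l; [|now apply expterm_le_half_exp].
    apply Rmult_le_pos; [apply Rabs_pos | apply Rlt_le, exp_pos].
  - replace (Rabs t * exp (- s) * (2 ^ N * exp (s / 2)))
      with (2 ^ N * (Rabs t * exp (- (s / 2)))).
    2: { replace (- s) with (- (s / 2) + - (s / 2)) by field.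
         assert (E : exp (s / 2) * exp (- (s / 2)) = 1)
           by (rewrite <- exp_plus, Rplus_opp_r; apply exp_0).
         rewrite exp_plus.
         replace (Rabs t * (exp (- (s / 2)) * exp (- (s / 2))) * (2 ^ N * exp (s / 2)))
           with (2 ^ N * (Rabs t * exp (- (s / 2))) * (exp (s / 2) * exp (- (s / 2)))) by ring.
         rewrite E; ring. }
    apply Rmult_le_compat_l; [apply pow_le; lra|].
    apply Rle_trans with (exp (Rabs t) * exp (- (s / 2))).
    + apply Rmult_le_compat_r; [apply Rlt_le, exp_pos|].
      generalize (exp_ineq1_le (Rabs t)); lra.
    + rewrite <- !exp_plus; apply exp_le_compat.
      assert (E : s / 2 = Rabs t ^ 2 / 4) by (unfold s; rewrite pow2_abs; field).
      rewrite E; generalize (Rle_abs t) (pow2_ge_0 (Rabs t / 2 - 2)); intros H1 H2.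
      simpl in H2 |- *; lra.
Qed.

(** For u = alpha^2/2 with alpha nonzero, the j-th term of alpha^(-M) t^(M+1) e^(-t^2/2) I_M(alpha
    t). *)
Definition marcum_term (u : R) (M : nat) (t : R) (j : nat) : R :=
  expterm u j * gauss_moment (j + M) t.

Lemma marcum_term_bound (u : R) (M : nat) (t : R) (j : nat) : 0 <= u ->
  Rabs (marcum_term u M t j) <= 2 ^ M * exp 4 * exp (- t) * expterm (2 * u) j.
Proof.
  intros Hu; unfold marcum_term; rewrite Rabs_mult.
  rewrite (Rabs_pos_eq (expterm u j)) by now apply expterm_nonneg.
  replace (2 ^ M * exp 4 * exp (- t) * expterm (2 * u) j)
    with (expterm u j * (2 ^ (j + M) * (exp 4 * exp (- t))))
    by (rewrite expterm_scale, pow_add; ring).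
  apply Rmult_le_compat_l; [now apply expterm_nonneg | apply gauss_moment_bound].
Qed.

Lemma sum_n_scal_Rmult (c : R) (a : nat -> R) (n : nat) :
  sum_n (fun j => c * a j) n = c * sum_n a n.
Proof. exact (sum_n_scal_l c a n). Qed.

Lemma is_series_scal_Rmult (c : R) (a : nat -> R) (l : R) :
  is_series a l -> is_series (fun j => c * a j) (c * l).
Proof. exact (is_series_scal c a l). Qed.

Lemma is_RInt_gen_sum_n (Fa Fb : (R -> Prop) -> Prop) (f : nat -> R -> R) (I : nat -> R) (J : nat) :
  Filter Fa -> Filter Fb ->
  (forall j, is_RInt_gen (f j) Fa Fb (I j)) ->
  is_RInt_gen (fun x => sum_n (fun j => f j x) J) Fa Fb (sum_n I J).
Proof.
  intros FFa FFb H.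
  assert (Hext : forall g h : R -> R, (forall x, g x = h x) ->
            forall l, is_RInt_gen g Fa Fb l -> is_RInt_gen h Fa Fb l).
  { intros g h Hgh l; apply is_RInt_gen_ext, filter_forall; intros ab x _; apply Hgh. }
  induction J as [|J IH].
  - rewrite sum_O; apply (Hext (f 0%nat)); [|apply H].
    intros x; now rewrite sum_O.
  - rewrite sum_Sn.
    apply (Hext (fun x => plus (sum_n (fun j => f j x) J) (f (S J) x))).
    + intros x; now rewrite sum_Sn.
    + now apply (is_RInt_gen_plus (fun x => sum_n (fun j => f j x) J) (f (S J))).
Qed.

Lemma continuous_sum_n (f : nat -> R -> R) (x : R) (J : nat) :
  (forall j, continuous (f j) x) -> continuous (fun x => sum_n (fun j => f j x) J) x.
Proof.
  intros H; induction J as [|J IH].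
  - apply (continuous_ext (f 0%nat)); [|apply H]; intros y; now rewrite sum_O.
  - apply (continuous_ext (fun x => plus (sum_n (fun j => f j x) J) (f (S J) x))).
    + intros y; now rewrite sum_Sn.
    + apply (continuous_plus (fun x => sum_n (fun j => f j x) J) (f (S J))); auto.
Qed.

(* With u = alpha^2/2 and y = beta^2/2 this is e^(y+u) (1 - Q_(M+1)(alpha, beta)). *)
Definition marcum_series (M : nat) (y u : R) : R :=
  Series (fun j => expterm u j * exp_tail y (j + M)).

Lemma marcum_series_ex (M : nat) (y u : R) : 0 <= y -> 0 <= u ->
  ex_series (fun j => expterm u j * exp_tail y (j + M)).
Proof.
  intros Hy Hu.
  apply ex_series_dominated with (fun j => exp_tail y M * expterm u j).
  - intros j; rewrite Rabs_pos_eq.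
    + rewrite Rmult_comm; apply Rmult_le_compat_r; [now apply expterm_nonneg|].
      rewrite Nat.add_comm; now apply exp_tail_decr.
    + apply Rmult_le_pos; [now apply expterm_nonneg | now apply exp_tail_nonneg].
  - eexists; apply is_series_scal_Rmult, is_series_expterm.
Qed.

Lemma exp_opp_mul (x : R) : exp (- x) * exp x = 1.
Proof. rewrite <- exp_plus, Rplus_opp_l; apply exp_0. Qed.

Lemma is_RInt_gen_marcum (M : nat) (u b : R) : 0 <= u ->
  is_RInt_gen (fun t => Series (marcum_term u M t)) (at_point b) (Rbar_locally p_infty)
    (exp u - exp (- (b ^ 2 / 2)) * marcum_series M (b ^ 2 / 2) u).
Proof.
  intros Hu; set (y := b ^ 2 / 2).
  assert (Hy : 0 <= y) by (unfold y; generalize (pow2_ge_0 b); lra).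
  apply is_RInt_gen_dominated_limit with
    (w := fun t => exp (- t)) (W := 0 - (- exp (- b)))
    (fJ := fun J t => sum_n (marcum_term u M t) J)
    (err := fun J => 2 ^ M * exp 4 * exp_tail (2 * u) J)
    (I := sum_n (fun j => expterm u j * (exp (- y) * sum_n (expterm y) (j + M)))); try apply _.
  - intros J; apply (is_RInt_gen_sum_n _ _ (fun j t => marcum_term u M t j)); try apply _.
    intros j; apply (is_RInt_gen_scal (gauss_moment (j + M)) (expterm u j)).
    apply is_RInt_gen_gauss_moment.
  - apply (is_RInt_gen_primitive _ _ (fun t => - exp (- t))); try apply _.
    + exists (fun x => x = b) (fun x => b < x); [reflexivity | now exists b |].
      intros x z -> Hz; simpl; split; [lra|].
      intros x Hx; split; [auto_derive; trivial; ring |].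
      apply (ex_derive_continuous (fun t => exp (- t))); auto_derive; trivial.
    + intros P HP; apply (locally_singleton _ _ HP).
    + apply filterlim_ext with (fun t => (-1) * exp (- t)); [intros; ring|].
      apply is_lim_exp_opp_infty.
  - replace (Finite 0) with (Finite (2 ^ M * exp 4 * 0)) by (f_equal; ring).
    apply is_lim_seq_mult'; [apply is_lim_seq_const | apply exp_tail_lim].
  - change (is_series (fun j => expterm u j * (exp (- y) * sum_n (expterm y) (j + M)))
              (exp u - exp (- y) * marcum_series M y u)).
    (* Since e^(-y) times the partial sum of e^y is 1 - e^(-y) T_j, each term splits into u^j/j!,
       summing to e^u, and a term of [marcum_series]. *)
    apply is_series_ext with
      (fun j => plus (expterm u j) (opp (exp (- y) * (expterm u j * exp_tail y (j + M))))).
    + intros j; unfold plus, opp; simpl; unfold exp_tail.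
      replace (expterm u j) with (expterm u j * (exp (- y) * exp y)) at 1
        by (rewrite exp_opp_mul; ring).
      ring.
    + apply (is_series_minus (expterm u)); [apply is_series_expterm|].
      now apply is_series_scal_Rmult, Series_correct, marcum_series_ex.
  - exists (fun x => x = b) (fun x => b < x); [reflexivity | now exists b |].
    intros x z -> Hz; simpl; split; [lra|]; intros t Ht; split; [split|].
    + apply Rlt_le, exp_pos.
    + apply (ex_derive_continuous (fun t => exp (- t))); auto_derive; trivial.
    + intros J; split.
      * apply (continuous_sum_n (fun j t => marcum_term u M t j)); intros j.
        apply (continuous_scal_r (expterm u j) (gauss_moment (j + M))), gauss_moment_continuous.
      * set (c := 2 ^ M * exp 4 * exp (- t)).
        assert (Hser : is_series (fun j => c * expterm (2 * u) j) (c * exp (2 * u)))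
          by apply is_series_scal_Rmult, is_series_expterm.
        apply Rle_trans with (c * exp (2 * u) - sum_n (fun j => c * expterm (2 * u) j) J).
        -- apply series_tail_bound; [|exact Hser |].
           ++ apply ex_series_dominated with (fun j => c * expterm (2 * u) j).
              ** intros j; now apply marcum_term_bound.
              ** eexists; exact Hser.
           ++ intros j _; now apply marcum_term_bound.
        -- right; rewrite sum_n_scal_Rmult; unfold c, exp_tail; ring.
Qed.

Lemma marcum_integrand_series (M : nat) (alpha t : R) :
  t ^ S M * exp (- (t ^ 2 + alpha ^ 2) / 2) * BesselI M (alpha * t) =
  alpha ^ M * exp (- (alpha ^ 2 / 2)) * Series (marcum_term (alpha ^ 2 / 2) M t).
Proof.
  unfold BesselI; rewrite <- !Series_scal_l; apply Series_ext; intros j.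
  rewrite <- plus_INR, Gamma_nat.
  unfold marcum_term, gauss_moment, expterm.
  replace (- (t ^ 2 + alpha ^ 2) / 2) with (- (t ^ 2 / 2) + - (alpha ^ 2 / 2)) by field.
  rewrite exp_plus.
  (* Of the 2j + M factors 1/2 in the Bessel term, j go to alpha^2/2 and j + M to t^2/2; the spare
     factor t is the one in [gauss_moment]. *)
  assert (E : t ^ S M * (alpha * t / 2) ^ (2 * j + M) =
              alpha ^ M * (alpha ^ 2 / 2) ^ j * (t * (t ^ 2 / 2) ^ (j + M))).
  { rewrite !pow_add, !pow_mult.
    replace ((alpha * t / 2) ^ 2) with ((alpha ^ 2 / 2) * (t ^ 2 / 2)) by field.
    replace ((t ^ 2 / 2) ^ M) with (t ^ M * (t / 2) ^ M)
      by (rewrite <- Rpow_mult_distr; f_equal; field).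
    replace (alpha * t / 2) with (alpha * (t / 2)) by field.
    rewrite !Rpow_mult_distr; simpl (t ^ S M); ring. }
  assert (H1 := INR_fact_neq_0 j); assert (H2 := INR_fact_neq_0 (j + M)).
  transitivity (exp (- (t ^ 2 / 2)) * exp (- (alpha ^ 2 / 2)) *
    (t ^ S M * (alpha * t / 2) ^ (2 * j + M)) / (INR (fact j) * INR (fact (j + M)))).
  - field; split; assumption.
  - rewrite E; field; split; assumption.
Qed.

Lemma MarcumQ_nz_eq (M : nat) (alpha b : R) : alpha <> 0 ->
  MarcumQ_nz (S M) alpha b =
  1 - exp (- (b ^ 2 / 2)) * (exp (- (alpha ^ 2 / 2)) * marcum_series M (b ^ 2 / 2) (alpha ^ 2 / 2)).
Proof.
  intros Ha; unfold MarcumQ_nz; replace (S M - 1)%nat with M by lia.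
  set (u := alpha ^ 2 / 2).
  assert (Hu : 0 <= u) by (unfold u; generalize (pow2_ge_0 alpha); lra).
  rewrite (is_RInt_gen_unique _ (alpha ^ M * exp (- u) *
    (exp u - exp (- (b ^ 2 / 2)) * marcum_series M (b ^ 2 / 2) u))).
  - replace (alpha ^ M * exp (- u) * (exp u - exp (- (b ^ 2 / 2)) * marcum_series M (b ^ 2 / 2) u))
      with (alpha ^ M * (exp (- u) * exp u -
              exp (- (b ^ 2 / 2)) * (exp (- u) * marcum_series M (b ^ 2 / 2) u))) by ring.
    rewrite exp_opp_mul, <- Rmult_assoc, Rinv_l; [ring | now apply pow_nonzero].
  - generalize (is_RInt_gen_scal _ (alpha ^ M * exp (- u)) _ (is_RInt_gen_marcum M u b Hu)).
    apply is_RInt_gen_ext, filter_forall; intros ab t _.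
    symmetry; apply marcum_integrand_series.
Qed.

Lemma marcum_series_approx (M : nat) (y u : R) (J : nat) : 0 <= y -> 0 <= u ->
  Rabs (marcum_series M y u - sum_n (fun j => expterm u j * exp_tail y (j + M)) J)
  <= exp_tail y (J + M) * exp u.
Proof.
  intros Hy Hu.
  assert (Ht := exp_tail_nonneg y (J + M) Hy).
  apply Rle_trans with (exp_tail y (J + M) * exp u -
    sum_n (fun j => exp_tail y (J + M) * expterm u j) J).
  - apply series_tail_bound; [now apply marcum_series_ex
      | apply is_series_scal_Rmult, is_series_expterm |].
    intros j Hj; rewrite Rabs_pos_eq.
    + rewrite Rmult_comm; apply Rmult_le_compat_r; [now apply expterm_nonneg|].
      replace (j + M)%nat with (J + M + (j - J))%nat by lia; now apply exp_tail_decr.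
    + apply Rmult_le_pos; [now apply expterm_nonneg | now apply exp_tail_nonneg].
  - rewrite sum_n_scal_Rmult.
    assert (0 <= sum_n (expterm u) J); [|assert (0 <= exp_tail y (J + M) * sum_n (expterm u) J)
      by (now apply Rmult_le_pos); lra].
    apply Rle_trans with (sum_n (expterm u) 0).
    + rewrite sum_O; now apply expterm_nonneg.
    + apply (sum_n_nonneg_le _ 0 J); intros; now apply expterm_nonneg.
Qed.

(** The lower bound is the term j = 0, the upper one replaces every T_j by T_0. They agree at u = 0,
    which settles the limit alpha -> 0. *)
Lemma marcum_series_bounds (M : nat) (y u : R) : 0 <= y -> 0 <= u ->
  exp_tail y M <= marcum_series M y u <= exp_tail y M * exp u.
Proof.
  intros Hy Hu; split.
  - replace (exp_tail y M) with (expterm u 0 * exp_tail y (0 + M))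
      by (unfold expterm; simpl; field).
    apply (term_le_series (fun j => expterm u j * exp_tail y (j + M))).
    + intros j; apply Rmult_le_pos; [now apply expterm_nonneg | now apply exp_tail_nonneg].
    + now apply Series_correct, marcum_series_ex.
  - rewrite <- (is_series_unique _ _ (is_series_scal_Rmult (exp_tail y M) _ _ (is_series_expterm u))).
    apply Series_le; [|eexists; apply is_series_scal_Rmult, is_series_expterm].
    intros j; split.
    + apply Rmult_le_pos; [now apply expterm_nonneg | now apply exp_tail_nonneg].
    + rewrite Rmult_comm; apply Rmult_le_compat_r; [now apply expterm_nonneg|].
      rewrite Nat.add_comm; now apply exp_tail_decr.
Qed.

Lemma marcum_series_0 (M : nat) (y : R) : 0 <= y -> marcum_series M y 0 = exp_tail y M.
Proof.
  intros Hy; generalize (marcum_series_bounds M y 0 Hy (Rle_refl 0)); rewrite exp_0; lra.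
Qed.

Lemma MarcumQ_eq (M : nat) (alpha b : R) :
  MarcumQ (S M) alpha b =
  1 - exp (- (b ^ 2 / 2)) * (exp (- (alpha ^ 2 / 2)) * marcum_series M (b ^ 2 / 2) (alpha ^ 2 / 2)).
Proof.
  unfold MarcumQ; destruct (Req_EM_T alpha 0) as [-> | Ha]; [|now apply MarcumQ_nz_eq].
  set (y := b ^ 2 / 2).
  assert (Hy : 0 <= y) by (unfold y; generalize (pow2_ge_0 b); lra).
  replace (0 ^ 2 / 2) with 0 by (simpl; field).
  rewrite Ropp_0, exp_0, marcum_series_0, Rmult_1_l by assumption.
  rewrite (is_lim_unique _ _ (Finite (1 - exp (- y) * exp_tail y M))); [reflexivity|].
  assert (Hey := exp_pos (- y)); assert (Ht := exp_tail_nonneg y M Hy).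
  (* Multiplied by e^(-u), the two bounds squeeze the function. The limit at 0 is punctured, so the
     formula for nonzero argument applies throughout. *)
  apply is_lim_le_le_loc with
    (f := fun _ => 1 - exp (- y) * exp_tail y M)
    (g := fun a => 1 - exp (- y) * (exp (- (a ^ 2 / 2)) * exp_tail y M)).
  - exists (mkposreal 1 Rlt_0_1); intros a _ Ha; rewrite (MarcumQ_nz_eq M a b Ha); fold y.
    set (u := a ^ 2 / 2).
    assert (Hu : 0 <= u) by (unfold u; generalize (pow2_ge_0 a); lra).
    destruct (marcum_series_bounds M y u Hy Hu) as [H1 H2].
    assert (Heu := exp_pos (- u)).
    assert (H3 : exp (- u) * marcum_series M y u <= exp_tail y M).
    { apply Rle_trans with (exp (- u) * (exp_tail y M * exp u)).
      - apply Rmult_le_compat_l; lra.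
      - right; rewrite <- (Rmult_1_r (exp_tail y M)) at 2; rewrite <- (exp_opp_mul u); ring. }
    assert (H4 : exp (- u) * exp_tail y M <= exp (- u) * marcum_series M y u)
      by (apply Rmult_le_compat_l; lra).
    split; apply Rplus_le_compat_l, Ropp_le_contravar, Rmult_le_compat_l; lra.
  - apply is_lim_const.
  - replace (1 - exp (- y) * exp_tail y M)
      with ((fun a => 1 - exp (- y) * (exp (- (a ^ 2 / 2)) * exp_tail y M)) 0)
      by (cbv beta; replace (- (0 ^ 2 / 2)) with 0 by (simpl; field); rewrite exp_0; ring).
    apply (is_lim_continuity (fun a => 1 - exp (- y) * (exp (- (a ^ 2 / 2)) * exp_tail y M))).
    apply continuity_pt_filterlim.
    apply (ex_derive_continuous (fun a => 1 - exp (- y) * (exp (- (a ^ 2 / 2)) * exp_tail y M))).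
    auto_derive; trivial.
Qed.

(** * Double series and Pochhammer symbols *)

Lemma is_series_sum_n (c : nat -> nat -> R) (l : nat -> R) (N : nat) :
  (forall n, is_series (c n) (l n)) ->
  is_series (fun j => sum_n (fun n => c n j) N) (sum_n l N).
Proof.
  intros H; induction N as [|N IH].
  - rewrite sum_O; apply is_series_ext with (2 := H 0%nat); intros j; now rewrite sum_O.
  - rewrite sum_Sn.
    apply is_series_ext with (fun j => plus (sum_n (fun n => c n j) N) (c (S N) j)).
    + intros j; now rewrite sum_Sn.
    + now apply (is_series_plus (fun j => sum_n (fun n => c n j) N)).
Qed.

(** Cutting column j at n = N leaves at most B j times the tail of A. Finite sums over n commute
    with the sum over j, and the total error, that tail times the sum of B, tends to 0. *)
Lemma Series_exchange (c : nat -> nat -> R) (A B : nat -> R) :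
  ex_series A -> ex_series B -> (forall n j, Rabs (c n j) <= A n * B j) ->
  is_series (fun j => Series (fun n => c n j)) (Series (fun n => Series (c n))).
Proof.
  intros HA HB Hc.
  assert (Hrow : forall n, ex_series (c n)).
  { intros n; apply ex_series_dominated with (1 := Hc n).
    destruct HB as [l Hl]; eexists; apply is_series_scal_Rmult, Hl. }
  assert (HBA : forall j, is_series (fun n => A n * B j) (Series A * B j)).
  { intros j; rewrite Rmult_comm.
    apply is_series_ext with (fun n => B j * A n); [intros; apply Rmult_comm|].
    now apply is_series_scal_Rmult, Series_correct. }
  assert (Hcol : forall j, ex_series (fun n => c n j)).
  { intros j; apply ex_series_dominated with (fun n => A n * B j); [auto|].
    eexists; apply HBA. }
  assert (HT : forall j N, Rabs (Series (fun n => c n j) - sum_n (fun n => c n j) N)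
                   <= (Series A - sum_n A N) * B j).
  { intros j N.
    replace ((Series A - sum_n A N) * B j)
      with (Series A * B j - sum_n (fun n => A n * B j) N).
    - apply series_tail_bound; auto.
    - rewrite (sum_n_ext _ (fun n => B j * A n)) by (intros; apply Rmult_comm).
      rewrite sum_n_scal_Rmult; ring. }
  assert (HexD : forall N, ex_series
            (fun j => Series (fun n => c n j) - sum_n (fun n => c n j) N)).
  { intros N; apply ex_series_dominated with (1 := fun j => HT j N).
    eexists; apply is_series_scal_Rmult, Series_correct, HB. }
  assert (Hsum : forall N, is_series (fun j => sum_n (fun n => c n j) N)
            (sum_n (fun n => Series (c n)) N)).
  { intros N; apply is_series_sum_n; intros n; now apply Series_correct. }
  assert (HexT : ex_series (fun j => Series (fun n => c n j))).
  { apply ex_series_ext with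
      (fun j => plus (Series (fun n => c n j) - sum_n (fun n => c n j) 0)
                     (sum_n (fun n => c n j) 0)).
    - intros j; unfold plus; simpl; ring.
    - apply (ex_series_plus _ _ (HexD 0%nat)); eexists; apply Hsum. }
  set (T := Series (fun j => Series (fun n => c n j))).
  assert (Hdist : forall N, Rabs (sum_n (fun n => Series (c n)) N - T)
                    <= (Series A - sum_n A N) * Series B).
  { intros N; rewrite Rabs_minus_sym.
    assert (E : T - sum_n (fun n => Series (c n)) N =
      Series (fun j => Series (fun n => c n j) - sum_n (fun n => c n j) N)).
    { rewrite <- (is_series_unique _ _ (Hsum N)); symmetry; apply Series_minus;
        [exact HexT | eexists; apply Hsum]. }
    rewrite E, <- Series_scal_l.
    assert (HexB : ex_series (fun j => (Series A - sum_n A N) * B j))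
      by (eexists; apply is_series_scal_Rmult, Series_correct, HB).
    eapply Rle_trans; [apply Series_Rabs | apply Series_le].
    - apply ex_series_dominated with (2 := HexB); intros j; rewrite Rabs_Rabsolu; apply HT.
    - intros j; split; [apply Rabs_pos | apply HT].
    - exact HexB. }
  replace (Series (fun n => Series (c n))) with T; [now apply Series_correct|].
  symmetry; apply is_series_unique.
  assert (Hlim : is_lim_seq (fun N => (Series A - sum_n A N) * Series B) 0).
  { replace (Finite 0) with (Finite ((Series A - Series A) * Series B)) by (f_equal; ring).
    apply is_lim_seq_mult'; [|apply is_lim_seq_const].
    apply is_lim_seq_minus'; [apply is_lim_seq_const | now apply Series_correct]. }
  change (is_lim_seq (sum_n (fun n => Series (c n))) T).
  apply is_lim_seq_le_le with
    (u := fun N => T - (Series A - sum_n A N) * Series B)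
    (w := fun N => T + (Series A - sum_n A N) * Series B).
  - intros N; generalize (proj1 (Rabs_le_between _ _) (Hdist N)); lra.
  - replace (Finite T) with (Finite (T - 0)) by (f_equal; ring).
    apply is_lim_seq_minus'; [apply is_lim_seq_const | exact Hlim].
  - replace (Finite T) with (Finite (T + 0)) by (f_equal; ring).
    apply is_lim_seq_plus'; [apply is_lim_seq_const | exact Hlim].
Qed.

Lemma Gamma_poch (k : R) (j : nat) : 0 < k -> Gamma (k + INR j) = Gamma k * poch k j.
Proof. intros Hk; unfold poch; field; apply Rgt_not_eq, Gamma_pos, Hk. Qed.

Lemma poch_0 (k : R) : 0 < k -> poch k 0 = 1.
Proof.
  intros Hk; unfold poch; simpl INR; rewrite Rplus_0_r.
  apply Rinv_r, Rgt_not_eq, Gamma_pos, Hk.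
Qed.

Lemma poch_succ (k : R) (j : nat) : 0 < k -> poch k (S j) = (k + INR j) * poch k j.
Proof.
  intros Hk; unfold poch; rewrite S_INR, <- Rplus_assoc.
  rewrite Gamma_succ by (generalize (pos_INR j); lra); unfold Rdiv; ring.
Qed.

Lemma poch_pos (k : R) (j : nat) : 0 < k -> 0 < poch k j.
Proof.
  intros Hk; apply Rdiv_lt_0_compat; apply Gamma_pos; generalize (pos_INR j); lra.
Qed.

Lemma poch_1 (n : nat) : poch 1 n = INR (fact n).
Proof. unfold poch; rewrite Rplus_comm, Gamma_nat, Gamma_1; field. Qed.

Lemma poch_nat (n l : nat) : poch (INR n + 1) l = INR (fact (n + l)) / INR (fact n).
Proof.
  unfold poch; rewrite Gamma_nat; f_equal.
  replace (INR n + 1 + INR l) with (INR (n + l) + 1) by (rewrite plus_INR; ring).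
  apply Gamma_nat.
Qed.

(** Each factor satisfies k + j <= (1 + k)(j + 1). The geometric excess (1 + k)^j is harmless,
    because a further 1/j! remains in the double series. *)
Lemma poch_le_fact (k : R) (j : nat) : 0 < k -> poch k j <= (1 + k) ^ j * INR (fact j).
Proof.
  intros Hk; induction j as [|j IH]; [rewrite poch_0 by assumption; simpl; lra|].
  rewrite poch_succ, fact_simpl, mult_INR, S_INR by assumption; simpl.
  assert (Hj := pos_INR j).
  replace ((1 + k) * (1 + k) ^ j * ((INR j + 1) * INR (fact j)))
    with (((1 + k) * (INR j + 1)) * ((1 + k) ^ j * INR (fact j))) by ring.
  apply Rmult_le_compat; try lra; [apply Rlt_le, poch_pos, Hk | nra].
Qed.

(** As n! j! <= (n + j)!, the mixed factor separates into the product majorant that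
    [Series_exchange] requires. *)
Lemma expterm_add_le (y : R) (n j : nat) : 0 <= y ->
  expterm y (n + j) <= expterm y n * expterm y j.
Proof.
  intros Hy; unfold expterm.
  assert (H1 := INR_fact_lt_0 n); assert (H2 := INR_fact_lt_0 j).
  replace (y ^ n / INR (fact n) * (y ^ j / INR (fact j)))
    with (y ^ (n + j) / (INR (fact n) * INR (fact j)))
    by (rewrite pow_add; field; lra).
  apply Rmult_le_compat_l; [now apply pow_le|].
  apply Rinv_le_contravar; [now apply Rmult_lt_0_compat|].
  rewrite <- mult_INR; apply le_INR.
  clear; induction n as [|n IH]; [simpl; lia|].
  rewrite Nat.add_succ_l, !fact_simpl; nia.
Qed.

Lemma is_series_expterm_shift (y : R) (M j : nat) :
  is_series (fun n => expterm y (n + j))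
    (exp_tail y (j + M) + sum_n (fun n => expterm y (n + j)) M).
Proof.
  apply (is_series_decr_n (fun n => expterm y (n + j)) (S M)); [lia|]; simpl pred.
  apply is_series_ext with (fun i => expterm y (S (j + M) + i)).
  - intros i; f_equal; lia.
  - apply (is_series_incr_n (expterm y)); [lia|]; simpl pred.
    replace (plus _ (sum_n (expterm y) (j + M))) with (exp y); [apply is_series_expterm|].
    set (S1 := sum_n (fun n => expterm y (n + j)) M); set (S2 := sum_n (expterm y) (j + M)).
    change (exp y = exp y - S2 + S1 + - S1 + S2); ring.
Qed.

(* Exchanging the two summations of Phi2 produces the complete sums of y^(n+j)/(n+j)!,
   and the 1F1 terms remove from them the indices n <= M. *)
Lemma is_series_poch_exp_tail (k w y : R) (M : nat) : 0 < k -> 0 <= w -> 0 <= y ->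
  is_series (fun j => poch k j * w ^ j / INR (fact j) * exp_tail y (j + M))
    (Phi2 1 k 1 y (w * y) - sum_n (fun n => expterm y n * hyp1F1 k (INR n + 1) (w * y)) M).
Proof.
  intros Hk Hw Hy.
  set (e := fun j => poch k j * w ^ j / INR (fact j)).
  set (c := fun n j => e j * expterm y (n + j)).
  assert (He : forall j, 0 <= e j).
  { intros j; apply Rdiv_le_0_compat; [|apply INR_fact_lt_0].
    apply Rmult_le_pos; [apply Rlt_le, poch_pos, Hk | now apply pow_le]. }
  assert (Hc : forall n j, Rabs (c n j) <= expterm y n * expterm ((1 + k) * w * y) j).
  { intros n j; unfold c; rewrite Rabs_pos_eq
      by (apply Rmult_le_pos; [apply He | now apply expterm_nonneg]).
    apply Rle_trans with (e j * (expterm y n * expterm y j)).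
    - apply Rmult_le_compat_l; [apply He | now apply expterm_add_le].
    - rewrite expterm_scale, Rpow_mult_distr.
      replace (e j * (expterm y n * expterm y j)) with (expterm y n * (e j * expterm y j)) by ring.
      apply Rmult_le_compat_l; [now apply expterm_nonneg|].
      apply Rmult_le_compat_r; [now apply expterm_nonneg|].
      unfold e; apply Rle_div_l; [apply INR_fact_lt_0|].
      replace ((1 + k) ^ j * w ^ j * INR (fact j)) with ((1 + k) ^ j * INR (fact j) * w ^ j) by ring.
      apply Rmult_le_compat_r; [now apply pow_le | now apply poch_le_fact]. }
  assert (Hexrow : forall n, ex_series (c n)).
  { intros n; apply ex_series_dominated with (1 := Hc n).
    eexists; apply is_series_scal_Rmult, is_series_expterm. }
  assert (Hswap := Series_exchange c _ _ (ex_intro _ _ (is_series_expterm y))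
                     (ex_intro _ _ (is_series_expterm ((1 + k) * w * y))) Hc).
  replace (Phi2 1 k 1 y (w * y)) with (Series (fun n => Series (c n))).
  (* Here (1)_n cancels n! and (1)_(n+l) is (n+l)!, while the powers of y in the two arguments
     combine into y^(n+l). *)
  2: { unfold Phi2; apply Series_ext; intros n; apply Series_ext; intros l.
       rewrite !poch_1, Rpow_mult_distr; unfold c, e, expterm; rewrite pow_add.
       field; repeat split; apply INR_fact_neq_0. }
  rewrite (sum_n_ext (fun n => expterm y n * hyp1F1 k (INR n + 1) (w * y)) (fun n => Series (c n))).
  2: { intros n; unfold hyp1F1; rewrite <- Series_scal_l; apply Series_ext; intros l.
       rewrite poch_nat, Rpow_mult_distr; unfold c, e, expterm; rewrite pow_add.
       field; repeat split; apply INR_fact_neq_0. }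
  apply is_series_ext with
    (fun j => plus (Series (fun n => c n j)) (opp (sum_n (fun n => c n j) M))).
  - intros j; unfold c.
    rewrite Series_scal_l, sum_n_scal_Rmult, (is_series_unique _ _ (is_series_expterm_shift y M j)).
    unfold plus, opp; simpl; unfold e; ring.
  - apply (is_series_minus (fun j => Series (fun n => c n j))); [exact Hswap|].
    apply is_series_sum_n; intros n; now apply Series_correct.
Qed.

(** * The integral *)

(* [ring] and [field] do not see through the carrier of Coquelicot's R_NormedModule. *)
Ltac equality_in_R := match goal with |- ?l = ?r => change (@eq R l r) end.

Lemma gamma_integrand_shift (k c x : R) (j : nat) : 0 < x ->
  gamma_integrand (k + INR j) c x = x ^ j * gamma_integrand k c x.
Proof.
  intros Hx; unfold gamma_integrand.
  replace (k + INR j - 1) with ((k - 1) + INR j) by ring.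
  rewrite Rpower_plus, Rpower_pow by assumption; ring.
Qed.

(** The factor e^(-alpha^2/2) of 1 - Q becomes e^(-a^2 x/2) and raises the exponential rate from p
    to p + a^2/2, the source of the powers of a^2 + 2p in the result. *)
Lemma F_integrand_eq (k : R) (M : nat) (a b p x : R) : 0 < x ->
  F_integrand k (S M) a b p x =
  gamma_integrand k p x -
  exp (- (b ^ 2 / 2)) *
    (gamma_integrand k (p + a ^ 2 / 2) x * marcum_series M (b ^ 2 / 2) (a ^ 2 / 2 * x)).
Proof.
  intros Hx; unfold F_integrand; rewrite MarcumQ_eq.
  replace ((a * sqrt x) ^ 2 / 2) with (a ^ 2 / 2 * x)
    by (rewrite Rpow_mult_distr, pow2_sqrt by lra; field).
  unfold gamma_integrand.
  replace (- ((p + a ^ 2 / 2) * x)) with (- (p * x) + - (a ^ 2 / 2 * x)) by ring.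
  rewrite exp_plus; replace (- p * x) with (- (p * x)) by ring; ring.
Qed.

Lemma is_RInt_gen_F_integrand (k : R) (M : nat) (a b p l : R) :
  0 < k -> 0 < p ->
  is_series (fun j => poch k j * (a ^ 2 / 2 / (p + a ^ 2 / 2)) ^ j / INR (fact j)
                      * exp_tail (b ^ 2 / 2) (j + M)) l ->
  is_RInt_gen (F_integrand k (S M) a b p) (at_right 0) (Rbar_locally p_infty)
    (Gamma k / Rpower p k
     - exp (- (b ^ 2 / 2)) * (Gamma k / Rpower (p + a ^ 2 / 2) k * l)).
Proof.
  intros Hk Hp Hl.
  set (y := b ^ 2 / 2) in *; set (d := a ^ 2 / 2) in *.
  assert (Hy : 0 <= y) by (unfold y; generalize (pow2_ge_0 b); lra).
  assert (Hd : 0 <= d) by (unfold d; generalize (pow2_ge_0 a); lra).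
  assert (Hey := exp_pos (- y)).
  assert (Hey1 : exp (- y) <= 1) by (rewrite <- exp_0; apply exp_le_compat; lra).
  set (coef := fun j => expterm d j * exp_tail y (j + M)).
  apply is_RInt_gen_dominated_limit with
    (w := gamma_integrand k p) (W := Gamma k / Rpower p k)
    (fJ := fun J x => gamma_integrand k p x -
       exp (- y) * sum_n (fun j => coef j * gamma_integrand (k + INR j) (p + d) x) J)
    (err := fun J => exp_tail y (J + M))
    (I := fun J => Gamma k / Rpower p k -
       exp (- y) * sum_n (fun j => coef j * (Gamma (k + INR j) / Rpower (p + d) (k + INR j))) J);
    try apply _.
  - intros J.
    apply (is_RInt_gen_minus (gamma_integrand k p)); [now apply gamma_integral_scaled|].
    apply (is_RInt_gen_scal
      (fun x => sum_n (fun j => coef j * gamma_integrand (k + INR j) (p + d) x) J)).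
    apply (is_RInt_gen_sum_n _ _ (fun j x => coef j * gamma_integrand (k + INR j) (p + d) x));
      try apply _.
    intros j; apply (is_RInt_gen_scal (gamma_integrand (k + INR j) (p + d)) (coef j)).
    apply gamma_integral_scaled; generalize (pos_INR j); lra.
  - now apply gamma_integral_scaled.
  - apply (is_lim_seq_incr_n (exp_tail y) M 0), exp_tail_lim.
  - apply is_lim_seq_minus'; [apply is_lim_seq_const|].
    apply is_lim_seq_mult'; [apply is_lim_seq_const|].
    change (is_series (fun j => coef j * (Gamma (k + INR j) / Rpower (p + d) (k + INR j)))
              (Gamma k / Rpower (p + d) k * l)).
    apply is_series_ext with (2 := is_series_scal_Rmult (Gamma k / Rpower (p + d) k) _ _ Hl).
    intros j; rewrite Gamma_poch, Rpower_plus, Rpower_pow by lra.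
    (* d^j comes from the coefficient u^j/j!, (p + d)^j from the Gamma integral of order k + j. *)
    replace ((d / (p + d)) ^ j) with (d ^ j / (p + d) ^ j)
      by (unfold Rdiv; now rewrite Rpow_mult_distr, pow_inv).
    unfold coef, expterm; equality_in_R.
    field; repeat split; try apply INR_fact_neq_0; try (apply Rgt_not_eq, Rpower_pos).
    apply pow_nonzero; lra.
  - apply at_right_0_infty_within; intros x Hx; split; [split|].
    + apply Rlt_le, gamma_integrand_pos.
    + now apply gamma_integrand_continuous.
    + intros J; split.
      * apply (continuous_minus (gamma_integrand k p)); [now apply gamma_integrand_continuous|].
        apply (continuous_scal_r (exp (- y))
          (fun x => sum_n (fun j => coef j * gamma_integrand (k + INR j) (p + d) x) J)).
        apply (continuous_sum_n (fun j x => coef j * gamma_integrand (k + INR j) (p + d) x)).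
        intros j; apply (continuous_scal_r (coef j) (gamma_integrand (k + INR j) (p + d))).
        now apply gamma_integrand_continuous.
      * rewrite F_integrand_eq by assumption; fold y; fold d.
        rewrite (sum_n_ext _ (fun j => gamma_integrand k (p + d) x *
                   (expterm (d * x) j * exp_tail y (j + M)))).
        2: { intros j; rewrite gamma_integrand_shift by assumption; unfold coef.
             rewrite (Rmult_comm d x), expterm_scale; equality_in_R; ring. }
        rewrite sum_n_scal_Rmult.
        assert (Hdx : 0 <= d * x) by (apply Rmult_le_pos; lra).
        assert (Happ := marcum_series_approx M y (d * x) J Hy Hdx).
        set (P := sum_n _ J) in *; set (Q := marcum_series M y (d * x)) in *.
        set (g := gamma_integrand k (p + d) x).
        assert (Hg : 0 < g) by apply gamma_integrand_pos.
        replace (gamma_integrand k p x - exp (- y) * (g * Q) -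
                 (gamma_integrand k p x - exp (- y) * (g * P)))
          with (- (exp (- y) * g * (Q - P))) by ring.
        rewrite Rabs_Ropp, Rabs_mult.
        rewrite (Rabs_pos_eq (exp (- y) * g)) by (apply Rmult_le_pos; lra).
        (* The e^u in the approximation error lowers the rate from p + d back to p, so the weight is
           [gamma_integrand k p], independent of J. *)
        assert (Egp : g * exp (d * x) = gamma_integrand k p x).
        { unfold g, gamma_integrand; rewrite Rmult_assoc, <- exp_plus; do 2 f_equal; ring. }
        apply Rle_trans with (1 * g * (exp_tail y (J + M) * exp (d * x))).
        -- apply Rmult_le_compat; [apply Rmult_le_pos; lra | apply Rabs_pos | | exact Happ].
           apply Rmult_le_compat_r; lra.
        -- right; rewrite <- Egp; ring.
Qed.

Theorem theorem3 (k : R) (m : nat) (a b p : R)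
  (hk : 0 < k) (hp : 0 < p) (hm : (1 <= m)%nat) :
  let z := a ^ 2 * b ^ 2 / (2 * a ^ 2 + 4 * p) in
  let C := Rpower 2 k * Gamma k * exp (- (b ^ 2 / 2)) / Rpower (a ^ 2 + 2 * p) k in
  is_RInt_gen (F_integrand k m a b p) (at_right 0) (Rbar_locally p_infty)
    (Gamma k / Rpower p k
     - C * Phi2 1 k 1 (b ^ 2 / 2) z
     + C * sum_n (fun n => b ^ (2 * n) / (INR (fact n) * 2 ^ n) * hyp1F1 k (INR n + 1) z) (m - 1)).
Proof.
  intros z C.
  destruct m as [|M]; [lia|]; replace (S M - 1)%nat with M by lia.
  assert (Ha := pow2_ge_0 a); assert (Hb := pow2_ge_0 b).
  set (w := a ^ 2 / 2 / (p + a ^ 2 / 2)).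
  assert (Hw : 0 <= w) by (apply Rdiv_le_0_compat; lra).
  assert (Hz : z = w * (b ^ 2 / 2)) by (unfold z, w; field; lra).
  (* The factor 2^k disappears because a^2 + 2p is twice the rate p + a^2/2. *)
  assert (HC : C = exp (- (b ^ 2 / 2)) * (Gamma k / Rpower (p + a ^ 2 / 2) k)).
  { unfold C; replace (a ^ 2 + 2 * p) with (2 * (p + a ^ 2 / 2)) by field.
    rewrite <- Rpower_mult_distr by lra.
    field; split; apply Rgt_not_eq, Rpower_pos. }
  rewrite (sum_n_ext _ (fun n => expterm (b ^ 2 / 2) n * hyp1F1 k (INR n + 1) (w * (b ^ 2 / 2)))).
  2: { intros n; rewrite Hz; f_equal; unfold expterm, Rdiv.
       rewrite Rpow_mult_distr, pow_inv, pow_mult, Rinv_mult; equality_in_R; ring. }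
  rewrite Hz, HC.
  assert (HS := is_series_poch_exp_tail k w (b ^ 2 / 2) M hk Hw ltac:(lra)).
  generalize (is_RInt_gen_F_integrand k M a b p _ hk hp HS).
  match goal with |- is_RInt_gen _ _ _ ?x -> is_RInt_gen _ _ _ ?y => replace y with x by ring end.
  trivial.
Qed.
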